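(* Let $G$ be a (finite) maximal triangle-free graph which does not contain the Mycielski–Grötzsch graph $\Upsilon$ as a subgraph and which satisfies property $\mathscr{D}_3$. Then $G$ is a blow-up of some Andrásfai graph $\Gamma_k$.
   Context: A graph is maximal triangle-free if it contains no triangle but adding any new edge between two non-adjacent vertices creates a triangle. A blow-up of $H$ is any graph obtained by replacing each vertex of $H$ by a non-empty independent set and each edge of $H$ by the complete bipartite graph between the corresponding sets, with no further edges. Property $\mathscr{D}_k$: for every $m\in\{1,\dots,k\}$ and every sequence $x_1,\dots,x_{3m}$ of (not necessarily distinct) vertices there is a vertex $y$ with $|\{i\in[3m]: x_iy\in E(G)\}|\ge m+1$. Andrásfai graph $\Gamma_k$ ($k\ge1$): vertex set $\mathbb Z/(3k-1)\mathbb Z$, $ij$ an edge iff $i-j\in\{k,\dots,2k-1\}$ mod $3k-1$. Mycielski–Grötzsch graph $\Upsilon$: vertices $a_j,b_j$ ($j\in\mathbb Z/5\mathbb Z$) and $c$; its 20 edges are all pairs $a_jc$, $a_jb_{j+2}$, $a_jb_{j-2}$, $b_jb_{j+2}$. *)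

(* Defs.v *)
From mathcomp Require Import all_boot.
Set Implicit Arguments. Unset Strict Implicit. Unset Printing Implicit Defensive.

Definition simple_graph (T : finType) (e : rel T) : Prop :=
  symmetric e /\ irreflexive e.

Definition triangle_free (T : finType) (e : rel T) : Prop :=
  forall x y z : T, ~ [&& e x y, e y z & e x z].

Definition add_edge (T : finType) (e : rel T) (x y : T) : rel T :=
  fun u v => [|| e u v, (u == x) && (v == y) | (u == y) && (v == x)].

Definition maximal_triangle_free (T : finType) (e : rel T) : Prop :=
  triangle_free e /\
  forall x y : T, x != y -> ~~ e x y -> ~ triangle_free (add_edge e x y).

Definition contains_subgraph (V T : finType) (h : rel V) (e : rel T) : Prop :=
  exists f : V -> T, injective f /\ forall u v, h u v -> e (f u) (f v).

(* G is a blow-up of H: vertices of H replaced by non-empty independent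
   sets (the fibres of a surjective map), edges by complete bipartite graphs,
   no further edges. *)
Definition blow_up_of (T V : finType) (e : rel T) (h : rel V) : Prop :=
  exists phi : T -> V, (forall v, exists x, phi x = v) /\
    forall x y, e x y = h (phi x) (phi y).

Definition property_D (k : nat) (T : finType) (e : rel T) : Prop :=
  forall m, 1 <= m <= k -> forall x : 'I_(3 * m) -> T,
    exists y : T, m < #|[set i : 'I_(3 * m) | e (x i) y]|.

Definition andrasfai (k : nat) : rel 'I_(3 * k - 1) :=
  fun i j => let d := (i + (3 * k - 1) - j) %% (3 * k - 1) in
             (k <= d) && (d <= 2 * k - 1).

(* Mycielski-Groetzsch graph: None = c, Some (false, j) = a_j,
   Some (true, j) = b_j, j in Z/5Z. *)
Definition diff2 (i j : 'I_5) : bool :=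
  (val j == (i + 2) %% 5) || (val i == (j + 2) %% 5).

Definition groetzsch : rel (option (bool * 'I_5)) :=
  fun u v => match u, v with
  | None, Some (false, _) | Some (false, _), None => true
  | Some (false, i), Some (true, j) | Some (true, j), Some (false, i) => diff2 i j
  | Some (true, i), Some (true, j) => diff2 i j
  | _, _ => false
  end.

(* Main.v *)
Require Import Defs.
From mathcomp Require Import all_boot.
From mathcomp Require Import zify.

(**
In such a graph non-adjacent vertices have a common neighbour.  The key point
is that there is no induced hexagon [a1 b2 a3 b1 a2 b3].  Choose a common
neighbour [ci] of the opposite vertices [ai], [bi].  Then D_2 applied to the
hexagon gives, up to symmetry, a vertex [a0] joined to all [bi]; D_3 applied to
all [ai], [bi], [ci] allows one to assume that [c3] is joined to [c1] and [c2];
and D_2 applied to [a1 b1 a2 b2 c1 c2] gives, up to symmetry, a vertex [y]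
joined to [a1], [b1], [c2].  These eleven vertices carry a Groetzsch graph with
centre [b1] and pentagon [a1 b2 c2 c3 b3].

Now let [h] be a copy of the Andrasfai graph on [k] with [k] maximal.  Without
induced hexagons the neighbours of a vertex [x] on [h] form an arc of at most
[k] vertices.  If the arc is shorter, say [x] is joined to [h (k - 1)] but not
to [h k] and [h 0], then hexagon-freeness forces common neighbours [y] of [x],
[h k] and [z] of [x], [h 0] to be twins of [h 0] and [h k], and
[h 0, y, h 1, .., h (k - 1), z, h k, .., h (2k - 1), x, h (2k), ..] is a
longer copy.  So every vertex is a twin of a vertex of [h], for every copy [h];
exchanging twins shows that the graph is a blow-up.
*)

(** * Common neighbours from property D *)

Lemma property_D_count (T : finType) (e : rel T) (K m : nat) (s : seq T) :
  symmetric e -> property_D K e -> 0 < m <= K -> size s = 3 * m ->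
  exists y, m < count (e y) s.
Proof.
move=> e_sym D m_range size_s.
have s_tupleP : size s == 3 * m by apply/eqP.
have [y ltmy] := D m m_range (tnth (Tuple s_tupleP)).
exists y; apply: leq_trans ltmy _.
rewrite cardsE cardE size_filter -enumT.
have {2}-> : s = map (tnth (Tuple s_tupleP)) (enum 'I_(3 * m)).
  by rewrite map_tnth_enum.
by rewrite count_map; apply: sub_count => i; rewrite !inE /= e_sym.
Qed.

Lemma nonadjacent_common_neighbour (T : finType) (e : rel T) (K : nat) :
  simple_graph e -> maximal_triangle_free e -> property_D K.+1 e ->
  forall x y, ~~ e x y -> exists z, e x z /\ e y z.
Proof.
move=> [e_sym e_irr] [tf e_max] D x y nexy.
suff /existsP[z /andP[]] : [exists z, e x z && e y z] by exists z.
have [<-|neq_xy] := eqVneq x y.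
  (* D_1 for the vertex [x] taken three times says that [x] has a neighbour. *)
  have [z] := @property_D_count _ _ _ 1 [:: x; x; x] e_sym D isT erefl.
  case exz: (e z x); rewrite /= exz // => _.
  by apply/existsP; exists z; rewrite andbb e_sym.
apply: contraT => /existsPn no_z; case: (e_max x y neq_xy nexy).
have no z : e x z -> e y z -> False by move=> a b; move: (no_z z); rewrite a b.
have no_sym z : e z x -> e z y -> False by rewrite !(e_sym z); exact: no.
have irr z : e z z -> False by rewrite e_irr.
have neq z : z != z -> False by rewrite eqxx.
move=> u v w /and3P[]; rewrite /add_edge.
move=> /or3P[euv|/andP[/eqP ? /eqP ?]|/andP[/eqP ? /eqP ?]];
move=> /or3P[evw|/andP[/eqP ? /eqP ?]|/andP[/eqP ? /eqP ?]];
move=> /or3P[euw|/andP[/eqP ? /eqP ?]|/andP[/eqP ? /eqP ?]]; subst.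
all: try by [apply: (neq _ neq_xy)|apply: irr; eassumption|eauto].
by apply: (tf u v w); rewrite euv evw.
Qed.

(** * Recognising a Groetzsch graph *)

Definition groetzsch_vertices : seq (option (bool * 'I_5)) :=
  None :: [seq Some (b, j) | b <- [:: false; true],
             j <- [:: Ordinal (isT : 0 < 5); Ordinal (isT : 1 < 5);
                      Ordinal (isT : 2 < 5); Ordinal (isT : 3 < 5);
                      Ordinal (isT : 4 < 5)]].

Lemma mem_groetzsch_vertices u : u \in groetzsch_vertices.
Proof. by case: u => [[[] [[|[|[|[|[|]]]]] ?]]|]. Qed.

(** A path [u z p w] closes to a triangle once [u] and [w] are identified. The finitely many pairs
    are checked by computation. *)
Lemma groetzsch_separated u w :
  u != w -> groetzsch u w \/
  exists z p, [&& groetzsch u z, groetzsch w p & groetzsch p z].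
Proof.
pose sep x y := [|| x == y, groetzsch x y |
  has (fun z => groetzsch x z &&
    has (fun p => groetzsch y p && groetzsch p z) groetzsch_vertices)
  groetzsch_vertices].
have /allP/(_ u (mem_groetzsch_vertices u)) :
  all (fun x => all (sep x) groetzsch_vertices) groetzsch_vertices.
  by vm_compute.
move=> /allP/(_ w (mem_groetzsch_vertices w)) /or3P[->//|->|]; first by left.
move=> /hasP[z _ /andP[uz /hasP[p _ /andP[wp pz]]]] _.
by right; exists z, p; rewrite uz wp.
Qed.

(* Identifying two non-adjacent vertices of the Groetzsch graph creates a
   triangle, so its homomorphic images in triangle-free graphs are copies. *)
Lemma groetzsch_hom_contains (T : finType) (e : rel T)
    (f : option (bool * 'I_5) -> T) :
  irreflexive e -> triangle_free e ->
  (forall u v, groetzsch u v -> e (f u) (f v)) -> contains_subgraph groetzsch e.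
Proof.
move=> e_irr tf f_hom; exists f; split=> // u w fuw.
have [//|/groetzsch_separated[/f_hom|[z [p /and3P[uz wp pz]]]]] := eqVneq u w.
  by rewrite fuw e_irr.
by case: (tf (f w) (f p) (f z));
  rewrite (f_hom _ _ wp) (f_hom _ _ pz) -fuw (f_hom _ _ uz).
Qed.

(** This is the Mycielski construction on a pentagon: each [wi] copies the pentagon neighbours of
    [vi], and [c] sees all copies. *)
Lemma groetzsch_of_twinned_pentagon (T : finType) (e : rel T)
    (c v0 v1 v2 v3 v4 w0 w1 w2 w3 w4 : T) :
  simple_graph e -> triangle_free e ->
  [&& e v0 v1, e v1 v2, e v2 v3, e v3 v4 & e v4 v0] ->
  [&& e c w0, e c w1, e c w2, e c w3 & e c w4] ->
  [&& e w0 v1, e w1 v2, e w2 v3, e w3 v4 & e w4 v0] ->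
  [&& e w0 v4, e w1 v0, e w2 v1, e w3 v2 & e w4 v3] ->
  contains_subgraph groetzsch e.
Proof.
move=> [e_sym e_irr] tf /and5P[? ? ? ? ?] /and5P[? ? ? ? ?] /and5P[? ? ? ? ?].
move=> /and5P[? ? ? ? ?].
(* In [groetzsch] the pentagon of the b_j advances by 2, so [vi] and [wi] go to index 2i mod 5. *)
pose f (u : option (bool * 'I_5)) := match u with
  | None => c
  | Some (false, j) => nth c [:: w0; w3; w1; w4; w2] (val j)
  | Some (true, j) => nth c [:: v0; v3; v1; v4; v2] (val j)
  end.
apply: (@groetzsch_hom_contains _ _ f) => //.
by move=> [[[] [[|[|[|[|[|?]]]]] ?]]|] [[[] [[|[|[|[|[|?]]]]] ?]]|] //= _;
   rewrite e_sym.
Qed.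

(** * Exclusion of induced hexagons *)

Section Hexagon.

Variables (T : finType) (e : rel T).
Hypotheses (e_simple : simple_graph e) (tf : triangle_free e).
Hypothesis common : forall x y, ~~ e x y -> exists z, e x z /\ e y z.
Hypotheses (D : property_D 3 e) (no_groetzsch : ~ contains_subgraph groetzsch e).

Let e_sym : symmetric e := e_simple.1.

Lemma adjacent_count x y z : e x y -> e z x + e z y <= 1.
Proof.
move=> exy; case zx: (e z x); case zy: (e z y) => //.
by case: (tf z x y); rewrite zx exy.
Qed.

Lemma punctured_cube_path_free a0 a1 a2 a3 b1 b2 b3 c1 c2 c3 :
  [&& e a1 b2, e a1 b3, e a2 b1, e a2 b3 & e a3 b1 && e a3 b2] ->
  [&& e a0 b1, e a0 b2 & e a0 b3] ->
  [&& e a1 c1, e a2 c2 & e a3 c3] -> [&& e b1 c1, e b2 c2 & e b3 c3] ->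
  e c3 c1 -> e c3 c2 -> False.
Proof.
move=> /and5P[a12 a13 a21 a23 /andP[a31 a32]] /and3P[a01 a02 a03].
move=> /and3P[ac1 ac2 ac3] /and3P[bc1 bc2 bc3] c31 c32.
have [y] := @property_D_count _ _ _ 2 [:: a1; b1; a2; b2; c1; c2] e_sym D isT erefl.
have := adjacent_count _ _ y a12; have := adjacent_count _ _ y a21.
have := adjacent_count _ _ y ac1; have := adjacent_count _ _ y ac2.
have := adjacent_count _ _ y bc1; have := adjacent_count _ _ y bc2.
rewrite /= => D1 D2 D3 D4 D5 D6 D7.
(* The six vertices lie on the cycle [a1 b2 c2 a2 b1 c1], so three independent ones are every other
   vertex of it. Exchanging the indices 1 and 2 swaps the two cases. *)
have /orP[/and3P[ya1 yb1 yc2]|/and3P[ya2 yb2 yc1]] :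
  [&& e y a1, e y b1 & e y c2] || [&& e y a2, e y b2 & e y c1].
  by move: D1 D2 D3 D4 D5 D6 D7;
     case: (e y a1); case: (e y b1); case: (e y a2);
     case: (e y b2); case: (e y c1); case: (e y c2).
- apply: no_groetzsch.
  apply: (@groetzsch_of_twinned_pentagon _ _ b1 a1 b2 c2 c3 b3 a0 y a3 a2 c1) => //;
  apply/and5P; split; by rewrite // e_sym.
- apply: no_groetzsch.
  apply: (@groetzsch_of_twinned_pentagon _ _ b2 a2 b1 c1 c3 b3 a0 y a3 a1 c2) => //;
  apply/and5P; split; by rewrite // e_sym.
Qed.

Lemma punctured_cube_free a0 a1 a2 a3 b1 b2 b3 :
  [&& e a1 b2, e a1 b3, e a2 b1, e a2 b3 & e a3 b1 && e a3 b2] ->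
  [&& e a0 b1, e a0 b2 & e a0 b3] -> [|| e a1 b1, e a2 b2 | e a3 b3].
Proof.
move=> hex a0b; apply: contraT; rewrite !negb_or => /and3P[n1 n2 n3].
have [[c1 [ac1 bc1]] [c2 [ac2 bc2]]] := (common _ _ n1, common _ _ n2).
have [c3 [ac3 bc3]] := common _ _ n3.
have [y] := @property_D_count _ _ _ 3 [:: a1; a2; a3; b1; b2; b3; c1; c2; c3]
  e_sym D isT erefl.
have /and5P[a12 a13 a21 a23 /andP[a31 a32]] := hex.
have /and3P[a01 a02 a03] := a0b.
have := adjacent_count _ _ y a12; have := adjacent_count _ _ y a21.
have := adjacent_count _ _ y a13; have := adjacent_count _ _ y a31.
have := adjacent_count _ _ y a23; have := adjacent_count _ _ y a32.
have := adjacent_count _ _ y ac1; have := adjacent_count _ _ y ac2.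
have := adjacent_count _ _ y bc1; have := adjacent_count _ _ y bc2.
have := adjacent_count _ _ y ac3; have := adjacent_count _ _ y bc3.
rewrite /= => D1 D2 D3 D4 D5 D6 D7 D8 D9 D10 D11 D12 D13.
(* A neighbour [ci] of [y] excludes [ai] and [bi], and [y] has at most as many neighbours on the
   hexagon as there are indices left, except that a single index allows both [ai] and [bi]. So four
   neighbours force this pattern, and [y] can replace [ci]. *)
have /or3P[/and4P[ya yb yc yc']|/and4P[ya yb yc yc']|/and4P[ya yb yc yc']] :
  [|| [&& e y a1, e y b1, e y c2 & e y c3], [&& e y a2, e y b2, e y c1 & e y c3]
   | [&& e y a3, e y b3, e y c1 & e y c2]].
  by move: D1 D2 D3 D4 D5 D6 D7 D8 D9 D10 D11 D12 D13;
     case: (e y a1); case: (e y a2); case: (e y a3); case: (e y b1);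
     case: (e y b2); case: (e y b3); case: (e y c1); case: (e y c2);
     case: (e y c3).
- case: (@punctured_cube_path_free a0 a2 a3 a1 b2 b3 b1 c2 c3 y) => //;
  by rewrite ?a12 ?a13 ?a21 ?a23 ?a31 ?a32 ?ac1 ?ac2 ?ac3 ?bc1 ?bc2 ?bc3
             ?a01 ?a02 ?a03 // !(e_sym _ y) ?ya ?yb.
- case: (@punctured_cube_path_free a0 a1 a3 a2 b1 b3 b2 c1 c3 y) => //;
  by rewrite ?a12 ?a13 ?a21 ?a23 ?a31 ?a32 ?ac1 ?ac2 ?ac3 ?bc1 ?bc2 ?bc3
             ?a01 ?a02 ?a03 // !(e_sym _ y) ?ya ?yb.
- case: (@punctured_cube_path_free a0 a1 a2 a3 b1 b2 b3 c1 c2 y) => //;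
  by rewrite ?a12 ?a13 ?a21 ?a23 ?a31 ?a32 ?ac1 ?ac2 ?ac3 ?bc1 ?bc2 ?bc3
             ?a01 ?a02 ?a03 // !(e_sym _ y) ?ya ?yb.
Qed.

(** Short chords would close triangles, so only the long diagonals [ai bi] can keep the hexagon from
    being induced. *)
Lemma hexagon_free a1 a2 a3 b1 b2 b3 :
  [&& e a1 b2, e a1 b3, e a2 b1, e a2 b3 & e a3 b1 && e a3 b2] ->
  [|| e a1 b1, e a2 b2 | e a3 b3].
Proof.
move=> hex; have [y] := @property_D_count _ _ _ 2 [:: a1; a2; a3; b1; b2; b3]
  e_sym D isT erefl.
have /and5P[a12 a13 a21 a23 /andP[a31 a32]] := hex.
have := adjacent_count _ _ y a12; have := adjacent_count _ _ y a21.
have := adjacent_count _ _ y a13; have := adjacent_count _ _ y a31.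
have := adjacent_count _ _ y a23; have := adjacent_count _ _ y a32.
rewrite /= => D1 D2 D3 D4 D5 D6 D7.
have /orP[ya|yb] :
  [&& e y a1, e y a2 & e y a3] || [&& e y b1, e y b2 & e y b3].
  by move: D1 D2 D3 D4 D5 D6 D7;
     case: (e y a1); case: (e y a2); case: (e y a3); case: (e y b1);
     case: (e y b2); case: (e y b3).
- rewrite (e_sym a1) (e_sym a2) (e_sym a3).
  apply: (@punctured_cube_free y) => //.
  by rewrite !(e_sym b1) !(e_sym b2) !(e_sym b3) a12 a13 a21 a23 a31 a32.
- exact: (@punctured_cube_free y).
Qed.

End Hexagon.

(** * Copies of Andrasfai graphs as periodic sequences *)

Lemma andrasfaiE k (u v : 'I_(3 * k - 1)) :
  0 < k ->
  andrasfai u v = (u + k <= v < u + 2 * k) || (v + k <= u < v + 2 * k).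
Proof.
move=> k0; have [un vn] := (ltn_ord u, ltn_ord v); rewrite /andrasfai.
have [le_vu|lt_uv] := leqP v u; last by rewrite modn_small; lia.
have -> : u + (3 * k - 1) - v = u - v + (3 * k - 1) by lia.
by rewrite modnDr modn_small; lia.
Qed.

Section Andrasfai.

Variables (T : finType) (e : rel T).
Hypotheses (e_simple : simple_graph e) (tf : triangle_free e).
Hypothesis common : forall x y, ~~ e x y -> exists z, e x z /\ e y z.
Hypothesis hexagon_free : forall a1 a2 a3 b1 b2 b3 : T,
  [&& e a1 b2, e a1 b3, e a2 b1, e a2 b3 & e a3 b1 && e a3 b2] ->
  [|| e a1 b1, e a2 b2 | e a3 b3].

Let e_sym : symmetric e := e_simple.1.

Lemma common_nonadjacent x y z : e x z -> e y z -> e x y = false.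
Proof.
move=> xz yz; apply/negP => xy; case: (tf x y z).
by rewrite xy yz.
Qed.

(* The residues modulo 3k-1 are unrolled to a periodic sequence, so that rotating
   a copy is a mere index shift. *)
Definition andrasfai_copy (k : nat) (h : nat -> T) : Prop :=
  (forall i, h (i + (3 * k - 1)) = h i) /\
  (forall i j, i + k <= j < i + 2 * k -> e (h i) (h j)).

Lemma andrasfai_copy_shift k h r :
  andrasfai_copy k h -> andrasfai_copy k (fun i => h (r + i)).
Proof.
move=> [hP hE]; split=> [i|i j ij]; first by rewrite addnA hP.
by apply: hE; lia.
Qed.

Lemma andrasfai_copy_mod k h i :
  andrasfai_copy k h -> h (i %% (3 * k - 1)) = h i.
Proof.
move=> [hP _]; rewrite {2}(divn_eq i (3 * k - 1)) addnC.
elim: (i %/ _) => [|q IHq]; first by rewrite mul0n addn0.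
by rewrite (mulSnr q) addnA hP.
Qed.

Lemma andrasfai_copy_nonadjacent k h i j :
  andrasfai_copy k h -> i <= j < i + k -> e (h i) (h j) = false.
Proof.
by move=> [_ hE] ij; apply: (common_nonadjacent (h i) (h j) (h (j + k)));
   apply: hE; lia.
Qed.

(** The range [k <= d < 2 * k] is stable under [d] to [3 * k - 1 - d], so a pair that wraps around
    is a pair within one period, read backwards. *)
Lemma andrasfai_copy_of_linear k g :
  0 < k -> (forall i j, i + k <= j < i + 2 * k -> j < 3 * k - 1 -> e (g i) (g j)) ->
  andrasfai_copy k (fun i => g (i %% (3 * k - 1))).
Proof.
move=> k0 gE; split=> [i|i j ij]; first by rewrite modnDr.
set n := 3 * k - 1.
have n0 : 0 < n by rewrite /n; lia.
have -> : j = (j - i) + i by lia.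
rewrite -(modnDmr (j - i)).
have := ltn_pmod i n0; set r := i %% n => rn.
have [lt_jn|le_nj] := ltnP (j - i + r) n.
  by rewrite (modn_small lt_jn); apply: gE => //; lia.
have -> : j - i + r = (j - i + r - n) + n by lia.
rewrite modnDr modn_small; last by rewrite /n in rn le_nj *; lia.
by rewrite e_sym; apply: gE => //; rewrite /n in rn le_nj *; lia.
Qed.

(** In the hexagon [h i], [x], [h j], [h (m + 2 * k - 1)], [h m], [h (m + k)] the two long diagonals
    other than [x], [h m] are missing. *)
Lemma andrasfai_copy_between k h x i j m :
  andrasfai_copy k h -> e x (h i) -> e x (h j) -> i <= m <= j -> j < i + k ->
  e x (h m).
Proof.
move=> hC xi xj imj ji.
have [->//|neq_mi] := eqVneq m i; have [->//|neq_mj] := eqVneq m j.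
have [hP hE] := hC.
have n1 : e (h i) (h (m + 2 * k - 1)) = false.
  by rewrite e_sym -(hP i) (andrasfai_copy_nonadjacent k) //; lia.
have n3 : e (h j) (h (m + k)) = false.
  by rewrite (andrasfai_copy_nonadjacent k) //; lia.
have := @hexagon_free (h i) (h m) (h j) (h (m + 2 * k - 1)) x (h (m + k)).
by rewrite n1 n3 orbF /= !(e_sym _ x) xi xj !hE; lia.
Qed.

Lemma andrasfai_copy_replace k h y :
  0 < k -> andrasfai_copy k h -> (forall i, k <= i < 2 * k -> e y (h i)) ->
  andrasfai_copy k
    (fun i => (fun r => if r == 0 then y else h r) (i %% (3 * k - 1))).
Proof.
move=> k0 [hP hE] yE.
apply: (andrasfai_copy_of_linear k (fun r => if r == 0 then y else h r)) => //.
move=> i j ij jn.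
have -> : (j == 0) = false by lia.
by have [i0|_] := eqVneq i 0; [apply: yE|apply: hE]; lia.
Qed.

(** * Extending a copy, and full arcs of neighbours *)

Lemma andrasfai_copy_extend k h x y z :
  0 < k -> andrasfai_copy k h -> e x y -> e x z ->
  (forall i, 0 < i < k -> e x (h i)) -> (forall i, k <= i < 2 * k -> e y (h i)) ->
  (forall i, 2 * k <= i < 3 * k -> e z (h i)) ->
  exists g, andrasfai_copy k.+1 g.
Proof.
move=> k0 [hP hE] xy xz xE yE zE.
have z0 : e z (h 0) by rewrite -(hP 0); apply: zE; lia.
(* The index shifts 1, 2, 3 count the vertices among [y], [z], [x] inserted so far. *)
pose g j := if j == 0 then h 0 else if j == 1 then y else if j <= k then h (j - 1)
  else if j == k.+1 then z else if j <= 2 * k + 1 then h (j - 2)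
  else if j == 2 * k + 2 then x else h (j - 3).
exists (fun i => g (i %% (3 * k.+1 - 1))).
apply: (andrasfai_copy_of_linear k.+1 g) => // i j ij jn; rewrite /g.
have -> : (j == 0) = false by lia.
have -> : (j == 1) = false by lia.
have -> : (j <= k) = false by lia.
case: (eqVneq i 0) => [i0|ni0].
  case: ifP => jk1; first by rewrite e_sym.
  by rewrite ifT; [apply: hE|]; lia.
have -> : (j == k.+1) = false by lia.
case: (eqVneq i 1) => [i1|ni1].
  case: ifP => j1; first by apply: yE; lia.
  by rewrite ifT; [rewrite e_sym|lia].
case: (leqP i k) => ik.
  case: ifP => j1; first by apply: hE; lia.
  case: ifP => j2; first by rewrite e_sym; apply: xE; lia.
  by apply: hE; lia.
have -> : (j <= 2 * k + 1) = false by lia.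
case: (eqVneq i k.+1) => [ik1|nik1].
  case: ifP => j2; first by rewrite e_sym.
  by apply: zE; lia.
have -> : (j == 2 * k + 2) = false by lia.
by rewrite ifT; [apply: hE|]; lia.
Qed.

Lemma andrasfai_copy_left_end k h x :
  0 < k -> andrasfai_copy k h -> ~ (exists g, andrasfai_copy k.+1 g) ->
  e x (h (k - 1)) -> ~~ e x (h k) -> e x (h 0).
Proof.
move=> k0 hC no_ext xk1 nxk; apply: contraT => nx0.
have [hP hE] := hC.
have k2 : 1 < k by case: (k) k0 xk1 nx0 => [|[|]] // _ ->.
have [y [xy yk]] := common _ _ nxk; rewrite (e_sym _ y) in yk.
have [z [xz z0]] := common _ _ nx0; rewrite (e_sym _ z) in z0.
have nonadj := andrasfai_copy_nonadjacent k h _ _ hC.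
have n1 : e (h (k - 1)) (h k) = false by apply: nonadj; lia.
have y2k1 : e y (h (2 * k - 1)).
  have := @hexagon_free y (h (k - 1)) (h 0) (h (2 * k - 1)) (h k) x.
  by rewrite n1 yk (e_sym y x) xy !(e_sym (h _) x) xk1 (negPf nx0) !hE; lia.
have yE i : k <= i < 2 * k -> e y (h i).
  by move=> ik; apply: (andrasfai_copy_between k h y k (2 * k - 1)) => //; lia.
(* Exchanging [h 0] for its twin [y] gives a copy on which [x] sees both ends of the arc from 0 to
   [k - 1]. *)
have xE i : 0 < i < k -> e x (h i).
  move=> ik.
  have hC' := andrasfai_copy_replace k h y k0 hC yE.
  have /= := andrasfai_copy_between _ _ x 0 (k - 1) i hC'.
  rewrite !modn_small ?eqxx; try lia.
  do 2 (rewrite ifF; last by lia).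
  by apply=> //; lia.
have n2 : e (h 1) (h 0) = false by rewrite e_sym; apply: nonadj; lia.
have z2k : e z (h (2 * k)).
  have := @hexagon_free z (h 1) (h k) (h (2 * k)) (h 0) x.
  rewrite n2 z0 (e_sym z x) xz !(e_sym (h _) x) xE ?(negPf nxk)
    ?(e_sym (h k) (h 0)) ?hE; lia.
case: no_ext; apply: (andrasfai_copy_extend k h x y z) => // i ik.
apply: (andrasfai_copy_between k h z (2 * k) (3 * k - 1)) => //; try lia.
by rewrite -[3 * k - 1]add0n hP.
Qed.

Lemma andrasfai_copy_meet_full k h x j :
  0 < k -> andrasfai_copy k h -> ~ (exists g, andrasfai_copy k.+1 g) ->
  e x (h j) -> exists q, forall i, q <= i < q + k -> e x (h i).
Proof.
move=> k0 hC no_ext xj; have [hP hE] := hC.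
have ex_i : exists i, ~~ e x (h (j + i)).
  exists k; rewrite (common_nonadjacent _ _ (h j)) //.
  by rewrite e_sym; apply: hE; lia.
case: (ex_minnP ex_i) => -[|i] nxi min_i; first by rewrite addn0 xj in nxi.
have xi : e x (h (j + i)).
  by apply: contraT => /min_i; rewrite ltnn.
(* This rotation moves the last neighbour [h (j + i)] to position [k - 1] and the first
   non-neighbour to position [k]. *)
pose r := j + i + 2 * k.
have hr : h (r + (k - 1)) = h (j + i) by rewrite -(hP (j + i)) /r; congr h; lia.
have x0 : e x (h (r + 0)).
  apply: (andrasfai_copy_left_end k (fun i => h (r + i))) => //=.
  - exact: andrasfai_copy_shift.
  - by rewrite hr.
  - suff -> : r + k = j + i.+1 + (3 * k - 1) by rewrite hP.
    by rewrite /r; lia.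
exists r => m rm; rewrite addn0 in x0; rewrite -hr in xi.
by apply: (andrasfai_copy_between k h x r (r + (k - 1))) => //; lia.
Qed.

Lemma andrasfai_copy_full k h x :
  0 < k -> andrasfai_copy k h -> ~ (exists g, andrasfai_copy k.+1 g) ->
  exists q, forall i, q <= i < q + k -> e x (h i).
Proof.
move=> k0 hC no_ext; have [hP hE] := hC.
have [/hasP[j _ xj]|/hasPn none] :=
  boolP (has (fun j => e x (h j)) (iota 0 (3 * k - 1))).
  exact: andrasfai_copy_meet_full xj.
have nx j : ~~ e x (h j).
  rewrite -(andrasfai_copy_mod _ _ j hC); apply: none.
  by rewrite mem_iota add0n ltn_mod; lia.
have [y [xy y0]] := common _ _ (nx 0); rewrite e_sym in y0.
(* If [k = 1], the edge [h 0], [h 1] extends to a pentagon through [z], [x], [y]. Otherwise [y] is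
   exchanged into the copy, where it is the only neighbour of [x], although [x] should have [k]
   consecutive ones. *)
have [k1|k2] : k = 1 \/ 1 < k by lia.
  have [z [xz z1]] := common _ _ (nx 1); rewrite e_sym in z1.
  case: no_ext; apply: (andrasfai_copy_extend k h x z y) => // i ik; try lia.
    by have -> : i = 1 by lia.
  have -> : i = 0 + (3 * k - 1) by lia.
  by rewrite hP.
have [q yE] := andrasfai_copy_meet_full k h y 0 k0 hC no_ext y0.
pose r := q + 2 * k - 1.
have hC' := andrasfai_copy_shift k h r hC.
have yE' i : k <= i < 2 * k -> e y (h (r + i)).
  move=> ik; have -> : r + i = q + (i - k) + (3 * k - 1) by rewrite /r; lia.
  by rewrite hP; apply: yE; lia.
have hC2 := andrasfai_copy_replace k _ y k0 hC' yE'.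
have [|p xp] := andrasfai_copy_meet_full k _ x 0 k0 hC2 no_ext.
  by rewrite mod0n eqxx.
have xp0 : p <= p < p + k by lia.
have xp1 : p <= p.+1 < p + k by lia.
have := xp _ xp1; case: ifP => [p1 _|_]; last by rewrite (negPf (nx _)).
have := xp _ xp0; case: ifP => [p0 _|_]; last by rewrite (negPf (nx _)).
have : 3 * k - 1 %| p.+1 - p by apply: dvdn_sub.
by rewrite subSnn dvdn1; lia.
Qed.

(** * Twins and the blow-up structure *)

Definition twin_of (k : nat) (h : nat -> T) (x : T) (u : nat) : Prop :=
  forall i, u + k <= i < u + 2 * k -> e x (h i).

(** For [u < v] some neighbour of [h u] is adjacent to some neighbour of [h v], which would put [x]
    in a triangle. The pair depends on how [v - u] compares with [k] and [2 * k]. *)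
Lemma twin_of_unique k h x u v :
  0 < k -> andrasfai_copy k h -> u < 3 * k - 1 -> v < 3 * k - 1 ->
  twin_of k h x u -> twin_of k h x v -> u = v.
Proof.
move=> k0 [hP hE]; wlog le_uv : u v / u <= v => [hwlog|] un vn xu xv.
  by case: (leqP u v) => uv; [|symmetry]; apply: hwlog => //; lia.
apply/eqP; apply: contraT => neq_uv.
have no i j : e x (h i) -> e x (h j) -> i + k <= j < i + 2 * k -> False.
  by move=> xi xj ij; case: (tf x (h i) (h j)); rewrite xi xj hE.
have [d1|d1] := ltnP (v - u) k.
  by case: (no (u + k) (v + 2 * k - 1)); [apply: xu|apply: xv|]; lia.
have [d2|d2] := ltnP (v - u) (2 * k).
  by case: (no (u + k) (v + k)); [apply: xu|apply: xv|]; lia.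
by case: (no (u + 2 * k - 1) (v + k)); [apply: xu|apply: xv|]; lia.
Qed.

Lemma twin_of_self k h u : andrasfai_copy k h -> twin_of k h (h u) u.
Proof. by move=> [_ hE] i; apply: hE. Qed.

Lemma andrasfai_copy_card k h :
  0 < k -> andrasfai_copy k h -> 3 * k - 1 <= #|T|.
Proof.
move=> k0 hC; have h_inj : injective (fun i : 'I_(3 * k - 1) => h i).
  move=> i j hij; apply: val_inj; apply: (twin_of_unique k h (h i)) => //=.
    exact: twin_of_self.
  by rewrite hij; apply: twin_of_self.
by have := leq_card _ h_inj; rewrite card_ord.
Qed.

Lemma andrasfai_copy_maximal k0 h0 :
  0 < k0 -> andrasfai_copy k0 h0 ->
  exists k h, [/\ 0 < k, andrasfai_copy k h & ~ exists g, andrasfai_copy k.+1 g].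
Proof.
move=> k0_gt0 hC0.
(* Storing one period in a tuple makes the existence of a copy decidable, as [ex_maxnP] requires;
   [h0 0] is only a default for [nth]. *)
pose P k := (0 < k) && [exists t : (3 * k - 1).-tuple T,
  [forall i : 'I_(3 * k - 1), forall j : 'I_(3 * k - 1),
    (i + k <= j < i + 2 * k) ==> e (nth (h0 0) t i) (nth (h0 0) t j)]].
have PE k h : 0 < k -> andrasfai_copy k h -> P k.
  move=> k_gt0 [hP hE]; rewrite /P k_gt0 /=.
  apply/existsP; exists [tuple h i | i < 3 * k - 1].
  apply/forallP => i; apply/forallP => j; apply/implyP => ij.
  by rewrite -!tnth_nth !tnth_mktuple hE.
have PC k : P k -> exists h, andrasfai_copy k h.
  move=> /andP[k_gt0 /existsP[t /forallP tE]].
  exists (fun i => nth (h0 0) t (i %% (3 * k - 1))).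
  apply: (andrasfai_copy_of_linear k (nth (h0 0) t)) => // i j ij jn.
  have i_n : i < 3 * k - 1 by lia.
  by move: (tE (Ordinal i_n)) => /forallP/(_ (Ordinal jn))/implyP; apply.
have exP : exists k, P k by exists k0; apply: PE hC0.
have ubP k : P k -> k <= #|T|.
  move=> Pk; have [h hC] := PC k Pk; case/andP: Pk => k_gt0 _.
  by apply: leq_trans (andrasfai_copy_card k h k_gt0 hC); lia.
case: (ex_maxnP exP ubP) => k Pk maxk; have [h hC] := PC k Pk.
exists k, h; split=> //; first by case/andP: Pk.
by move=> [g gC]; have := maxk k.+1 (PE k.+1 g isT gC); rewrite ltnn.
Qed.

Lemma andrasfai_copy_blow_up k h :
  0 < k -> andrasfai_copy k h -> ~ (exists g, andrasfai_copy k.+1 g) ->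
  blow_up_of e (@andrasfai k).
Proof.
move=> k0 hC no_ext; have [hP hE] := hC.
have twin_ex g x : andrasfai_copy k g -> exists u : 'I_(3 * k - 1), twin_of k g x u.
  move=> gC; have [q xq] := andrasfai_copy_full k g x k0 gC no_ext.
  (* The arc starting at [q] belongs to position [q + 2 * k - 1], since adding [k] gives [q] plus
     one period. *)
  have u_lt : (q + 2 * k - 1) %% (3 * k - 1) < 3 * k - 1 by rewrite ltn_mod; lia.
  exists (Ordinal u_lt) => i /= ui.
  have := divn_eq (q + 2 * k - 1) (3 * k - 1).
  move: (_ %/ _) (_ %% _) ui => c u ui Dq.
  rewrite -(andrasfai_copy_mod k g i gC) -(modnMDl c) (andrasfai_copy_mod k g _ gC).
  move: (c * _) Dq => cn Dq.
  have -> : cn + i = cn + i - (3 * k - 1) + (3 * k - 1) by lia.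
  by rewrite (proj1 gC); apply: xq; lia.
have [phi phiP] := fin_all_exists (fun x => twin_ex h x hC).
have tw_eq x (u : 'I_(3 * k - 1)) : twin_of k h x u -> phi x = u.
  move=> xu; apply: val_inj.
  exact: (twin_of_unique k h x _ _ k0 hC (ltn_ord _) (ltn_ord _) (phiP x) xu).
exists phi; split=> [u|x y].
  by exists (h u); apply: tw_eq; apply: twin_of_self.
rewrite andrasfaiE //.
move: (nat_of_ord (phi x)) (ltn_ord (phi x)) (phiP x) => u un xu.
move: (nat_of_ord (phi y)) (ltn_ord (phi y)) (phiP y) => v vn yv.
apply/idP/idP => [xy|uv].
  apply: contraT => nuv.
  have no i : e x (h i) -> e y (h i) -> false.
    by move=> xi yi; rewrite (common_nonadjacent x y (h i)) in xy.
  have [d1|d1] := boolP (u <= v < u + k).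
    by apply: (no (v + k)); [apply: xu|apply: yv]; lia.
  have [d2|d2] := boolP (v <= u < v + k).
    by apply: (no (u + k)); [apply: xu|apply: yv]; lia.
  have [d3|d3] := leqP u v.
    apply: (no (u + k + (3 * k - 1))); last by apply: yv; lia.
    by rewrite hP; apply: xu; lia.
  apply: (no (v + k + (3 * k - 1))); first by apply: xu; lia.
  by rewrite hP; apply: yv; lia.
apply: contraT => nxy.
(* Rotate [h u] to 0 and exchange it for [x]. Then [y] is a twin of some [w'] there; as it misses
   [x], it is also a twin of [w'] in the old copy. So [w' = w], and position [w] is adjacent to 0,
   where [x] sits. *)
pose w := if u <= v then v - u else v + (3 * k - 1) - u.
have wn : w < 3 * k - 1 by rewrite /w; case: ifP; lia.
have wk : k <= w < 2 * k by rewrite /w; case: ifP; lia.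
have hC2 := andrasfai_copy_shift k h u hC.
have yw : twin_of k (fun i => h (u + i)) y w.
  rewrite /w => i; case: ifP => le_uv ik; first by apply: yv; lia.
  have -> : u + i = u + i - (3 * k - 1) + (3 * k - 1) by lia.
  by rewrite hP; apply: yv; lia.
have xE i : k <= i < 2 * k -> e x (h (u + i)) by move=> ik; apply: xu; lia.
have gC := andrasfai_copy_replace k _ x k0 hC2 xE.
have [w' yw'] := twin_ex _ y gC.
have yw2 : twin_of k (fun i => h (u + i)) y w'.
  move=> i /yw'; case: ifP => _; first by rewrite e_sym (negPf nxy).
  by rewrite (andrasfai_copy_mod k _ i hC2).
have ww := twin_of_unique k _ y w w' k0 hC2 wn (ltn_ord w') yw yw2.
have := yw' (3 * k - 1); rewrite modnn eqxx e_sym (negPf nxy); apply; lia.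
Qed.

End Andrasfai.

Theorem theorem1p3 (T : finType) (e : rel T) :
  0 < #|T| ->
  simple_graph e ->
  maximal_triangle_free e ->
  ~ contains_subgraph groetzsch e ->
  property_D 3 e ->
  exists k : nat, 0 < k /\ blow_up_of e (@andrasfai k).
Proof.
move=> /card_gt0P[x _] e_simple e_max no_groetzsch D.
have common := nonadjacent_common_neighbour T e 2 e_simple e_max D.
have hex_free := hexagon_free T e e_simple e_max.1 common D no_groetzsch.
have [y [xy _]] : exists y, e x y /\ e x y by apply: common; rewrite e_simple.2.
(* An edge is a copy for [k = 1], of period 2. *)
have hC : andrasfai_copy T e 1 (fun i => nth x [:: x; y] (i %% 2)).
  apply: (andrasfai_copy_of_linear T e e_simple 1 (nth x [:: x; y])) => //.
  by move=> [|i] [|[|j]] //=; lia.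
have [k [h [k_gt0 kC no_ext]]] :=
  andrasfai_copy_maximal T e e_simple e_max.1 1 _ isT hC.
exists k; split=> //.
exact: (andrasfai_copy_blow_up T e e_simple e_max.1 common hex_free k h).
Qed.
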